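(* Let $B$ be a symmetric positive definite $d\times d$ real matrix, let $v=(v_1,\dots,v_\kappa)$ be the vertices of a convex polytope $\mathcal{K}\subset\mathbb{R}^d$, and suppose that there is $c>0$ with $\frac12\langle Bv_i,v_i\rangle=c$ for all $i\in\{1,\dots,\kappa\}$. Define the $B$-norm Voronoi cells $$\mathsf{Vor}_B(v_i):=\left\{x\in\mathbb{R}^d:\ \|x-v_i\|_B\le\|x-v_j\|_B\ \text{ for all }j\in\{1,\dots,\kappa\}\right\}.$$ Then, for each $i\in\{1,\dots,\kappa\}$, $$\mathscr{C}_i(v)=\mathsf{Vor}_B(v_i)\cap\mathcal{K}.$$
   Context: $\langle\cdot,\cdot\rangle$ is the Euclidean inner product on $\mathbb{R}^d$, and $\|x\|_B:=\sqrt{\langle Bx,x\rangle}$. The cells are $$\mathscr{C}_i(v):=\left\{x\in\mathcal{K}:\ \langle Bx,v_i\rangle=\max_{y\in\mathcal{K}}\langle Bx,y\rangle\right\},\qquad i\in\{1,\dots,\kappa\}.$$ *)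

(* Defs.v *)
From HB Require Import structures.
From mathcomp Require Import all_boot all_order all_algebra.
From mathcomp Require Import mathcomp_extra boolp classical_sets cardinality.
From mathcomp Require Import reals convex.

Set Implicit Arguments.
Unset Strict Implicit.
Unset Printing Implicit Defensive.

Import Order.TTheory GRing.Theory Num.Theory.

Local Open Scope classical_set_scope.
Local Open Scope ring_scope.

Section Definitions.
Variables (R : realType) (d : nat).
Implicit Types (B : 'M[R]_d) (K S : set 'cV[R]_d) (x y z : 'cV[R]_d).

Definition inner x y : R := \sum_(k < d) x k 0 * y k 0.

Definition sym_posdef B : Prop :=
  B^T = B /\ forall x, x != 0 -> 0 < inner (B *m x) x.

Definition normB B x : R := Num.sqrt (inner (B *m x) x).

Definition convex_hull S : set 'cV[R]_d := smallest (@convex_set R 'cV[R]_d) S.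

Definition polytope K : Prop := exists2 S, finite_set S & K = convex_hull S.

(* The vertices of a polytope are its extreme points. *)
Definition vertex K x : Prop :=
  K x /\ forall y z (t : R), K y -> K z -> 0 < t < 1 ->
    x = t *: y + (1 - t) *: z -> y = x /\ z = x.

Definition vertices_of n K (v : 'I_n -> 'cV[R]_d) : Prop :=
  injective v /\ range v = [set x | vertex K x].

Definition is_max (A : set R) (a : R) : Prop := A a /\ ubound A a.

Definition cell n B K (v : 'I_n -> 'cV[R]_d) (i : 'I_n) : set 'cV[R]_d :=
  [set x | K x /\ is_max [set inner (B *m x) y | y in K] (inner (B *m x) (v i))].

Definition vorB n B (v : 'I_n -> 'cV[R]_d) (i : 'I_n) : set 'cV[R]_d :=
  [set x | forall j, normB B (x - v i) <= normB B (x - v j)].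

End Definitions.

(* Main.v *)
(** A convex polytope is the convex hull of its vertices, since a generator [x]
    that is not extreme can be dropped: if [x = t *: y + (1 - t) *: z]
    nontrivially, then [y - x] and [z - x] lie in the convex cone spanned by
    [w - x] for [w] in the hull [C] of the other generators, and a positive
    combination of them vanishes, so [C x]. Hence the linear form
    [inner (B *m x)] is maximal over [K] at [v i] iff it is so among the
    vertices; as all vertices have the same [B]-norm, expanding the squared
    [B]-norm of [x - v j] turns this into the Voronoi condition. *)
Require Import Defs.
From HB Require Import structures.
From mathcomp Require Import all_boot all_order all_algebra.
From mathcomp Require Import mathcomp_extra boolp classical_sets cardinality.
From mathcomp Require Import reals convex.
From mathcomp Require Import interval_inference ring lra.

Import Order.TTheory GRing.Theory Num.Theory.

Local Open Scope classical_set_scope.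
Local Open Scope ring_scope.

Lemma convex_setP {R : realType} {d : nat} (A : set 'cV[R]_d) :
  convex_set A <->
  forall y z (p q : R), A y -> A z -> 0 <= p -> 0 <= q -> p + q = 1 ->
    A (p *: y + q *: z).
Proof.
split=> [cA y z p q Ay Az p0 q0 pq|cA y z l].
  have p1 : p <= 1 by lra.
  have -> : q = 1 - p by lra.
  by have /(_ (Itv01 p0 p1)) := cA y z; rewrite !in_setE; apply.
rewrite !in_setE => Ay Az; apply: cA => //.
- by rewrite subr_ge0.
- by rewrite addrC subrK.
Qed.

Lemma convex_hull_convex {R : realType} {d : nat} (S : set 'cV[R]_d) :
  convex_set (convex_hull S).
Proof.
apply/convex_setP => y z p q Ky Kz p0 q0 pq A [cA SA].
by move/convex_setP: (cA); apply=> //; [apply: Ky|apply: Kz].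
Qed.

Section Cone.
Variables (R : realType) (d : nat) (C : set 'cV[R]_d) (x : 'cV[R]_d).
Hypothesis convexC : convex_set C.

(** The multiplier is strictly positive, so [0] belongs to this cone only when [x] itself lies in
    [C]. *)
Definition cone_at (u : 'cV[R]_d) : Prop :=
  exists b w, [/\ 0 < b, C w & u = b *: (w - x)].

Lemma cone_atZ p u : 0 < p -> cone_at u -> cone_at (p *: u).
Proof.
move=> p0 [b [w [b0 Cw ->]]]; exists (p * b), w; split=> //.
  exact: mulr_gt0.
by rewrite scalerA.
Qed.

(** Two rays add up to the ray through the mean of [w] and [w'] with weights proportional to [b] and
    [b'], a point of [C] by convexity. *)
Lemma cone_atD u u' : cone_at u -> cone_at u' -> cone_at (u + u').
Proof.
move=> [b [w [b0 Cw ->]]] [b' [w' [b'0 Cw' ->]]].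
have bb0 : 0 < b + b' by exact: addr_gt0.
have bbn0 : b + b' != 0 by rewrite gt_eqF.
exists (b + b'), ((b / (b + b')) *: w + (b' / (b + b')) *: w'); split=> //.
  move/convex_setP: convexC; apply=> //; try by rewrite divr_ge0 // ltW.
  by rewrite -mulrDl divff.
rewrite !scalerBr scalerDr !scalerA scalerDl opprD.
by rewrite !(mulrC (b + b')) !divfK // addrACA.
Qed.

Lemma cone_at0 : cone_at 0 -> C x.
Proof.
move=> [b [w [b0 Cw /esym/eqP]]].
by rewrite scaler_eq0 gt_eqF //= subr_eq0 => /eqP <-.
Qed.

(** The point [x] is adjoined because [cone_at] need not contain [0]; the set can then hold every
    generator of a hull, including [x]. *)
Lemma convex_set_cone_at : convex_set [set y | y = x \/ cone_at (y - x)].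
Proof.
apply/convex_setP => y z p q Jy Jz p0 q0 pq /=.
have -> : p *: y + q *: z = x + (p *: (y - x) + q *: (z - x)).
  by rewrite !scalerBr addrACA -opprD -scalerDl pq scale1r [x + _]addrC subrK.
rewrite (addrC x) addrK.
have Jsc r w : 0 <= r -> w = x \/ cone_at (w - x) ->
    r *: (w - x) = 0 \/ cone_at (r *: (w - x)).
  rewrite le_eqVlt => /predU1P[<- _|r0 [->|cw]]; first by left; rewrite scale0r.
    by left; rewrite subrr scaler0.
  by right; exact: cone_atZ.
case: (Jsc _ _ p0 Jy) => [->|cy]; case: (Jsc _ _ q0 Jz) => [->|cz].
- by left; rewrite addr0 add0r.
- by right; rewrite add0r.
- by right; rewrite addr0.
- by right; exact: cone_atD.
Qed.

End Cone.

Arguments cone_at {R d}.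

Lemma convex_hull_drop {R : realType} {d : nat} (S : set 'cV[R]_d)
    (x : 'cV[R]_d) :
  S x -> ~ vertex (convex_hull S) x -> convex_hull S = convex_hull (S `\ x).
Proof.
move=> Sx nvx; set C := convex_hull (S `\ x).
have cC : convex_set C by exact: convex_hull_convex.
have KJ : convex_hull S `<=` [set y | y = x \/ cone_at C x (y - x)].
  apply: smallest_sub; first exact: convex_set_cone_at.
  move=> y Sy; have [->|/eqP yx] := eqVneq y x; [by left|right].
  exists 1, y; split=> //; last by rewrite scale1r.
  by apply: sub_gen_smallest; split.
have Cx : C x.
  (* Assuming [x] outside [C], extremality of [x] is checked, against [nvx]. *)
  apply: contrapT => nCx; apply: nvx; split; first exact: sub_gen_smallest.
  move=> y z t Ky Kz /andP[t0 t1] xE.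
  have t'0 : 0 < 1 - t by rewrite subr_gt0.
  have sum0 : t *: (y - x) + (1 - t) *: (z - x) = 0.
    rewrite !scalerBr addrACA -xE -opprD -scalerDl.
    by rewrite [t + _]addrC subrK scale1r subrr.
  (* If one of [y], [z] is [x], then [sum0] forces the other to be [x], its coefficient being
     nonzero; otherwise [sum0] puts [0] in the cone, hence [x] in [C]. *)
  case: (KJ _ Ky) (KJ _ Kz) => [yx|cy] [zx|cz]; first by [].
  - move: sum0; rewrite yx subrr scaler0 add0r => /eqP.
    by rewrite scaler_eq0 gt_eqF //= subr_eq0 => /eqP.
  - move: sum0; rewrite zx subrr scaler0 addr0 => /eqP.
    by rewrite scaler_eq0 gt_eqF //= subr_eq0 => /eqP.
  - exfalso; apply: nCx; apply: (cone_at0 _ _ C x); rewrite -sum0.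
    by apply: cone_atD => //; exact: cone_atZ.
apply/seteqP; split; apply: smallest_sub => //; try exact: convex_hull_convex.
- move=> y Sy; have [->//|/eqP yx] := eqVneq y x.
  by apply: sub_gen_smallest; split.
- by move=> y [Sy _]; exact: sub_gen_smallest.
Qed.

Lemma polytope_vertices {R : realType} {d : nat} (K : set 'cV[R]_d) :
  polytope K -> K = convex_hull [set x | vertex K x].
Proof.
move=> [S /finite_seqP[s ->] KE].
have [s' [KE' vs']] : exists s' : seq 'cV[R]_d,
    K = convex_hull [set` s'] /\ forall x, x \in s' -> vertex K x.
  (* Induction on a bound for the length of the generating list; [K] stays fixed, so being a vertex
     means the same throughout. *)
  have [n] := ubnP (size s); elim: n s KE => // n IH s KE /ltnSE sn.
  case: (pselect (forall x, x \in s -> vertex K x)) => [vs|]; first by exists s.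
  move/existsNP => [x /not_implyP[xs nvx]].
  (* Filtering removes every copy of [x], and the list gets strictly shorter since [x] occurs in
     it. *)
  apply: (IH [seq y <- s | y != x]); last first.
    apply: leq_trans sn; rewrite size_filter -(count_predC (pred1 x) s).
    by rewrite -[X in (X < _)%N]add0n ltn_add2r -has_count has_pred1.
  rewrite {1}KE (@convex_hull_drop _ _ _ x) //; last by rewrite -KE.
  congr convex_hull; apply/seteqP; split=> y /=; rewrite mem_filter.
    by move=> [ys /eqP yx]; rewrite yx.
  by move=> /andP[/eqP].
apply/seteqP; split.
  rewrite {1}KE'; apply: smallest_sub; first exact: convex_hull_convex.
  by move=> x /= /vs' vx; exact: sub_gen_smallest.
apply: smallest_sub; first by rewrite KE; exact: convex_hull_convex.
by move=> x [].
Qed.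

Lemma innerE {R : realType} {d : nat} (x y : 'cV[R]_d) :
  inner x y = (x^T *m y) 0 0.
Proof. by rewrite mxE; apply: eq_bigr => k _; rewrite mxE. Qed.

Lemma innerC {R : realType} {d : nat} (x y : 'cV[R]_d) : inner x y = inner y x.
Proof. by apply: eq_bigr => k _; rewrite mulrC. Qed.

Lemma inner_linear_comb {R : realType} {d : nat} (x y z : 'cV[R]_d) (p q : R) :
  inner x (p *: y + q *: z) = p * inner x y + q * inner x z.
Proof. by rewrite !innerE mulmxDr -!scalemxAr !mxE. Qed.

Lemma inner_sym {R : realType} {d : nat} (B : 'M[R]_d) (x y : 'cV[R]_d) :
  B^T = B -> inner (B *m x) y = inner (B *m y) x.
Proof.
by move=> Bs; rewrite (innerC (B *m y)) !innerE trmx_mul Bs mulmxA.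
Qed.

Lemma inner_sqrB {R : realType} {d : nat} (B : 'M[R]_d) (x y : 'cV[R]_d) :
  B^T = B -> inner (B *m (x - y)) (x - y) =
    inner (B *m x) x - 2 * inner (B *m x) y + inner (B *m y) y.
Proof.
move=> Bs; have -> : x - y = 1 *: x + (-1) *: y by rewrite scale1r scaleN1r.
(* Symmetry of [B] moves the difference into the second argument, where linearity applies again. *)
rewrite inner_linear_comb !(@inner_sym _ _ B (_ + _)) // !inner_linear_comb.
rewrite (inner_sym _ y x) //; ring.
Qed.

Lemma sym_posdef_ge0 {R : realType} {d : nat} (B : 'M[R]_d) (x : 'cV[R]_d) :
  sym_posdef B -> 0 <= inner (B *m x) x.
Proof.
move=> [_ Bpos]; have [->|x0] := eqVneq x 0; last exact/ltW/Bpos.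
by rewrite innerE mulmx0 mxE.
Qed.

(** A closed half-space is convex, so it contains the hull once it contains the generators. *)
Lemma inner_le_convex_hull {R : realType} {d : nat} (S : set 'cV[R]_d)
    (u : 'cV[R]_d) (a : R) :
  (forall y, S y -> inner u y <= a) ->
  forall y, convex_hull S y -> inner u y <= a.
Proof.
move=> Sa; apply: smallest_sub => //.
apply/convex_setP => y z p q /= ya za p0 q0 pq.
rewrite inner_linear_comb; have -> : a = p * a + q * a by rewrite -mulrDl pq mul1r.
by apply: lerD; exact: ler_wpM2l.
Qed.

(** After squaring, the terms free of cross products cancel, and the factor [-2] reverses the
    inequality. *)
Lemma normB_le {R : realType} {d : nat} (B : 'M[R]_d) (x y z : 'cV[R]_d) :
  sym_posdef B -> inner (B *m y) y = inner (B *m z) z ->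
  (normB B (x - y) <= normB B (x - z)) = (inner (B *m x) z <= inner (B *m x) y).
Proof.
move=> Bpos yz; have [Bs _] := Bpos.
rewrite /normB ler_sqrt ?sym_posdef_ge0 // !inner_sqrB // yz.
by rewrite lerD2r lerD2l lerN2 ler_pM2l.
Qed.

Theorem proposition4p5 (R : realType) (d kappa : nat) (B : 'M[R]_d)
    (K : set 'cV[R]_d) (v : 'I_kappa -> 'cV[R]_d) (c : R) :
  sym_posdef B ->
  polytope K ->
  vertices_of K v ->
  0 < c ->
  (forall i : 'I_kappa, 2^-1 * inner (B *m v i) (v i) = c) ->
  forall i : 'I_kappa, cell B K v i = vorB B v i `&` K.
Proof.
move=> Bpos polyK [_ vK] _ vc i.
have vv j k : inner (B *m v j) (v j) = inner (B *m v k) (v k).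
  by have := vc j; have := vc k; lra.
have vertv j : vertex K (v j).
  by have : [set x | vertex K x] (v j) by rewrite -vK; exists j.
apply/seteqP; split=> x /=.
  move=> [Kx [_ ub]]; split=> // j; rewrite normB_le //.
  by apply: ub; exists (v j) => //; have [] := vertv j.
move=> [vorx Kx]; split=> //; split.
  by exists (v i) => //; have [] := vertv i.
(* The Voronoi condition bounds the form at the vertices only; writing [K] as their hull extends the
   bound to all of [K]. *)
move=> _ [y Ky <-]; move: y Ky; rewrite (polytope_vertices _ polyK) -vK.
apply: inner_le_convex_hull => _ [j _ <-].
by rewrite -(normB_le _ _ _ _ Bpos (vv i j)).
Qed.
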